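(* Let $m\ge 3$ and $n\ge 2$ be integers, let $P$ be a generic axis-aligned $mn$-gon in $\mathbb{R}^m$, and let $T_m$ be the $m$-dimensional corrugated pentagram map. Then $T_m^{n-1}(P)$ collapses to a point, and this point is the center of mass of $P$; that is, all vertices of $T_m^{n-1}(P)$ are equal to $\mathscr C(P)$.
   Context: $\mathbb{P}^m$ is real projective space, containing $\mathbb{R}^m$. A polygon is a cyclically ordered sequence of points $V_1,\dots,V_k$ (indices mod $k$). A closed polygon $V_1V_2\cdots V_k$ in $\mathbb{R}^m$ is axis-aligned if for each $i$ the edge $V_iV_{i+1}$ is parallel to the $x_j$-axis, where $j\equiv i \pmod m$, $1\le j\le m$ (so $m\mid k$; write $k=mn$). In other words $V_i$ and $V_{i+1}$ have the same coordinates except possibly the $j$-th one. The space of axis-aligned $mn$-gons is a real vector space (parametrized by the free coordinates), and ''generic'' means: for all polygons in some nonempty Zariski-open subset of it. The center of mass $\mathscr C(P)$ of an axis-aligned $mn$-gon is the arithmetic mean of its $mn$ vertices. A polygon $V$ in $\mathbb{P}^m$ is corrugated if for every $i$ the vertices $V_i,V_{i+1},V_{i+m},V_{i+m+1}$ span a projective plane (axis-aligned polygons in $\mathbb{R}^m$ are corrugated by construction). The corrugated pentagram map $T_m$ sends a corrugated polygon $V$ to the polygon whose vertices, in cyclic order, are the intersection points of the successive $m$-diagonals $V_iV_{i+m}$ and $V_{i+1}V_{i+m+1}$; the image of a corrugated polygon is again corrugated, so $T_m$ can be iterated as long as the intersection points are well defined (the two points spanning each diagonal are distinct and successive diagonals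 are distinct lines). *)

(* Defs.v *)
From HB Require Import structures.
From mathcomp Require Import all_boot all_order all_algebra.
From mathcomp Require Import classical_sets reals mpoly.

Set Implicit Arguments.
Unset Strict Implicit.
Unset Printing Implicit Defensive.

Import GRing.Theory.
Local Open Scope classical_set_scope.
Local Open Scope ring_scope.

(* i + d modulo k *)
Definition shift (k d : nat) (i : 'I_k) : 'I_k := iter d (@ordS k) i.

(* P^m over R, as the set of lines through the origin of R^(m+1). *)
Record projpt (R : realType) (m : nat) := ProjPt {
  pt_space :> {vspace 'rV[R]_m.+1};
  _ : \dim pt_space == 1%N }.

HB.instance Definition _ (R : realType) (m : nat) :=
  [isSub for @pt_space R m].
HB.instance Definition _ (R : realType) (m : nat) :=
  [Equality of projpt R m by <:].

(* The inclusion of R^m in P^m, v |-> [1 : v]. *)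
Fact affine_pt_subproof (R : realType) (m : nat) (v : 'rV[R]_m) :
  \dim <[row_mx (1%:M : 'rV[R]_1) v : 'rV[R]_m.+1]>%VS == 1%N.
Proof.
rewrite dim_vline; suff -> : (row_mx 1%:M v : 'rV[R]_m.+1) != 0 by [].
apply/eqP => e0.
move: (congr1 (fun w : 'rV[R]_(1 + m) => lsubmx w 0 0) e0).
by rewrite row_mxKl linear0 !mxE eqxx => /eqP; rewrite oner_eq0.
Qed.

Definition affine_pt (R : realType) (m : nat) (v : 'rV[R]_m) : projpt R m :=
  ProjPt (affine_pt_subproof v).

Definition polygon (R : realType) (m k : nat) := {ffun 'I_k -> projpt R m}.

(* The span of V_i and V_(i+m); it is a projective line when these two points
   are distinct. *)
Definition diagonal (R : realType) (m k : nat) (V : polygon R m k)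
    (i : 'I_k) : {vspace 'rV[R]_m.+1} :=
  (V i + V (shift m i))%VS.

(* A projective plane of P^m is a 3-dimensional subspace of R^(m+1). *)
Definition corrugated (R : realType) (m k : nat) (V : polygon R m k) : bool :=
  [forall i : 'I_k,
    \dim (V i + V (shift 1 i) + V (shift m i) + V (shift m.+1 i))%VS == 3%N].

Definition pentagram_defined (R : realType) (m k : nat)
    (V : polygon R m k) : bool :=
  [&& corrugated V,
      [forall i : 'I_k, V i != V (shift m i)] &
      [forall i : 'I_k, diagonal V i != diagonal V (shift 1 i)]].

Lemma dim_diagonal_cap (R : realType) (m k : nat) (V : polygon R m k)
    (i : 'I_k) :
  pentagram_defined V ->
  \dim (diagonal V i :&: diagonal V (shift 1 i))%VS == 1%N.
Proof.
case/and3P=> /forallP /(_ i) /eqP corr /forallP neq _.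
have dim2 j : \dim (diagonal V j) = 2%N.
  have := neq j; rewrite /diagonal.
  case: (V j) (V (shift m j)) => [U dU] [W dW]; rewrite -val_eqE /= => UW.
  have := dimv_sum_cap U W; rewrite (eqP dU) (eqP dW) /=.
  suff -> : \dim (U :&: W)%VS = 0%N by rewrite addn0.
  have := dimvS (capvSl U W); rewrite (eqP dU).
  case: (\dim (U :&: W)%VS =P 0%N) => // /eqP; rewrite -lt0n => c0 c1.
  have c : \dim (U :&: W)%VS = 1%N by apply/eqP; rewrite eqn_leq c1.
  case/eqP: UW; transitivity (U :&: W)%VS.
    by apply/esym/eqP; rewrite eqEdim capvSl c (eqP dU).
  by apply/eqP; rewrite eqEdim capvSr c (eqP dW).
have := dimv_sum_cap (diagonal V i) (diagonal V (shift 1 i)).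
rewrite !dim2.
suff -> : \dim (diagonal V i + diagonal V (shift 1 i)) = 3%N.
  by move=> h; rewrite -(eqn_add2l 3) h.
rewrite -corr /diagonal; congr (\dim _).
have -> : shift m (shift 1 i) = shift m.+1 i by rewrite /shift /= -iterSr.
by rewrite !addvA -(addvA (V i)) [(V (shift m i) + _)%VS]addvC addvA.
Qed.

(* The corrugated pentagram map, a partial map. The default value [V i] of
   [insubd] is never used, by [dim_diagonal_cap]. *)
Definition pentagram (R : realType) (m k : nat) (V : polygon R m k) :
    option (polygon R m k) :=
  if pentagram_defined V then
    Some [ffun i => insubd (V i) (diagonal V i :&: diagonal V (shift 1 i))%VS]
  else None.

Definition pentagram_iter (R : realType) (m k d : nat) (V : polygon R m k) :
    option (polygon R m k) :=
  iter d (obind (@pentagram R m k)) (Some V).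

(* A closed k-gon of R^m is a k x m matrix whose rows are its vertices. Vertices
   and coordinates are numbered from 0, so that row i and column j stand for
   V_(i+1) and x_(j+1). *)
Definition axis_aligned (R : realType) (m n : nat) :
    set 'M[R]_(m * n, m) :=
  [set P | forall (i : 'I_(m * n)) (j : 'I_m),
     (j : nat) <> (i %% m)%N -> P (shift 1 i) j = P i j].

Definition center_of_mass (R : realType) (m k : nat) (P : 'M[R]_(k, m)) :
    'rV[R]_m :=
  k%:R^-1 *: \sum_(i < k) row i P.

Definition proj_polygon (R : realType) (m k : nat) (P : 'M[R]_(k, m)) :
    polygon R m k :=
  [ffun i => affine_pt (row i P)].

(* U is open in the Zariski topology of A, where A is a set of matrices and
   polynomials are taken in the matrix entries. When A is a linear subspace,
   these are the same open sets as those given by linear coordinates on A. *)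
Definition zariski_open_in (R : realType) (p q : nat)
    (A U : set 'M[R]_(p, q)) : Prop :=
  exists F : set {mpoly R[p * q]},
    U = A `&` [set P | exists2 f, F f & f.@[fun i => mxvec P 0 i] != 0].

Definition generically (R : realType) (p q : nat) (A : set 'M[R]_(p, q))
    (Q : 'M[R]_(p, q) -> Prop) : Prop :=
  exists U : set 'M[R]_(p, q),
    [/\ zariski_open_in A U, U !=set0 & forall P, U P -> Q P].

(* Main.v *)
(* Let [x q] be the coordinate of the vertex V_q in the direction of its next
   edge, [a q = x (q + m) - x q], and [W p = (1, V_p)].  By induction on d the
   i-th vertex of T_m^d (P) is represented by [\sum_(l <= d) c_l W_(i+lm)],
   where c spans the line of solutions of the d equations
   [\sum_l c_l a_(i+s+lm) = 0], s < d; the equations for s < r say precisely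
   that the sum does not change when i is replaced by i+r.  Solutions c are
   stored as polynomials, so that 'X * c is the shift i -> i + m, and
   consecutive m-diagonals then meet at the solution of order d+1.
   For d = n - 1 the edges of each direction sum to zero, so c = (1, ..., 1)
   is the solution, and it gives n times the center of mass.
   This works as soon as all the determinants of (a_(q+s+lm))_(s, l < d),
   d < n, are nonzero.  Each of them is nonzero at some polygon, and a line
   joining two polygons shows that finitely many nonzero polynomials have a
   common nonzero. *)

From HB Require Import structures.
Require Import Defs.
From mathcomp Require Import all_boot all_order all_algebra.
From mathcomp Require Import classical_sets reals mpoly.
From mathcomp Require Import zify.

Set Implicit Arguments.
Unset Strict Implicit.
Unset Printing Implicit Defensive.

Import GRing.Theory Num.Theory.
Local Open Scope ring_scope.

(** * Combinations of a sequence in steps of [m], with polynomial coefficients *)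

Section Comb.
Variables (F : fieldType) (m : nat).
Implicit Types b c e : {poly F}.

Definition comb (V : lmodType F) (u : nat -> V) (p : nat) (c : {poly F}) : V :=
  \sum_(l < size c) c`_l *: u (p + l * m)%N.

Lemma comb_wide (V : lmodType F) (u : nat -> V) p c N :
  (size c <= N)%N -> comb u p c = \sum_(l < N) c`_l *: u (p + l * m)%N.
Proof.
move=> leN; rewrite /comb (big_ord_widen N (fun l => c`_l *: u (p + l * m)%N)) //.
rewrite big_mkcond; apply: eq_bigr => l _; case: ltnP => // le_l.
by rewrite nth_default // scale0r.
Qed.

Lemma comb_is_linear (V : lmodType F) (u : nat -> V) p : linear (comb u p).
Proof.
move=> a b c; pose N := maxn (size (a *: b + c)) (maxn (size b) (size c)).
rewrite !(@comb_wide _ _ _ _ N) ?leq_max ?leqnn ?orbT // scaler_sumr -big_split.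
by apply: eq_bigr => l _; rewrite coefD coefZ scalerDl scalerA.
Qed.

HB.instance Definition _ (V : lmodType F) (u : nat -> V) p :=
  GRing.isLinear.Build F {poly F} V *:%R (comb u p) (comb_is_linear u p).

Lemma combX (V : lmodType F) (u : nat -> V) p c :
  comb u p ('X * c) = comb u (p + m) c.
Proof.
rewrite (@comb_wide _ _ _ _ (size c).+1); last first.
  by rewrite (leq_trans (size_polyMleq _ _)) // size_polyX.
rewrite big_ord_recl coefXM scale0r add0r; apply: eq_bigr => l _.
by rewrite coefXM lift0 /= mulSn addnA.
Qed.

Lemma comb_shift (V : lmodType F) (u : nat -> V) p r c :
  comb u (p + r) c = comb (fun q => u (q + r)%N) p c.
Proof. by apply: eq_bigr => l _; rewrite addnAC. Qed.

(** Since ['X] shifts the index by [m], multiplying by ['X - 1] is the difference operator that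
    turns [x] into edges. *)
Lemma comb_mul_subX1 (x : nat -> F^o) p b :
  comb x p (b * ('X - 1%:P)) = comb (fun q => x (q + m)%N - x q : F^o) p b.
Proof.
rewrite mulrBr mulr1 linearB /= mulrC combX comb_shift -sumrB.
by apply: eq_bigr => l _; rewrite -scalerBr.
Qed.

Lemma comb_const p c : comb (fun=> 1 : F^o) p c = c.[1].
Proof.
by rewrite horner_coef; apply: eq_bigr => l _; rewrite expr1n.
Qed.

Lemma comb_coord k (W : nat -> 'rV[F]_k) p c j :
  comb W p c 0 j = comb (fun q => W q 0 j : F^o) p c.
Proof. by rewrite summxE; apply: eq_bigr => l _; rewrite mxE. Qed.

Lemma eq_comb (V : lmodType F) (u v : nat -> V) p q c :
  (forall l, u (p + l * m)%N = v (q + l * m)%N) -> comb u p c = comb v q c.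
Proof. by move=> uv; apply: eq_bigr => l _; rewrite uv. Qed.

End Comb.

(** * Linear relations between edges under nondegeneracy *)

Section Relations.
Variables (F : fieldType) (m n : nat) (a : nat -> F^o).
Implicit Types b c e : {poly F}.
Local Notation comb := (@comb F m _).

(** Here [c] has only [d] coefficients, one fewer than in [relation]: the [d] by [d] systems are
    invertible. *)
Definition nondegenerate := forall d q (c : {poly F}), (d < n)%N ->
  (size c <= d)%N -> (forall s, (s < d)%N -> comb a (q + s) c = 0) -> c = 0.

Definition relation d i (c : {poly F}) :=
  (size c <= d.+1)%N /\ forall s, (s < d)%N -> comb a (i + s) c = 0.

Lemma nondegenerate_det :
  (forall d q, (d < n)%N ->
     \det (\matrix_(l < d, s < d) a (q + s + l * m)%N) != 0) -> nondegenerate.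
Proof.
move=> det_n0 d q c dn sc c0; apply/eqP; apply: contraNT (det_n0 d q dn) => cn0.
apply/det0P; exists (poly_rV c).
  by apply: contra cn0 => /eqP e; rewrite -(poly_rV_K sc) e linear0.
apply/rowP => s; rewrite !mxE -[RHS](c0 s (ltn_ord s)) (comb_wide _ _ _ sc).
by apply: eq_bigr => l _; rewrite !mxE.
Qed.

Hypothesis nd : nondegenerate.

Lemma relation_top d i c : (d < n)%N -> relation d i c -> c`_d = 0 -> c = 0.
Proof.
move=> dn [sc rc] cd; apply: (nd dn _ rc).
apply/leq_sizeP => j; rewrite leq_eqVlt => /predU1P[<- //|ltj].
by move/leq_sizeP: sc; apply.
Qed.

Lemma polyX_factor (c : {poly F}) d : c`_0 = 0 -> (size c <= d.+1)%N ->
  exists2 b, c = 'X * b & (size b <= d)%N.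
Proof.
move=> c0 sc; have /factor_theorem[b] : root c 0 by rewrite /root horner_coef0 c0.
rewrite subr0 => eb; exists b; first by rewrite mulrC.
have [-> | bn0] := eqVneq b 0; first by rewrite size_poly0.
by move: sc; rewrite eb size_mulX.
Qed.

(** Dividing by ['X] leaves [d] coefficients that satisfy the equations based at [i + m]. *)
Lemma relation_low d i c : (d < n)%N -> relation d i c -> c`_0 = 0 -> c = 0.
Proof.
move=> dn [sc rc] c0; have [b eb sb] := polyX_factor c0 sc.
rewrite eb (nd (q := i + m) dn sb) ?mulr0 // => s sd.
by rewrite addnAC -combX -eb rc.
Qed.

Lemma relationD d i c e : relation d i c -> relation d i e -> relation d i (c + e).
Proof.
move=> [sc rc] [se re]; split=> [|s sd]; last by rewrite linearD /= rc // re // addr0.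
by rewrite (leq_trans (size_polyD _ _)) // geq_max sc.
Qed.

Lemma relationZ d i k c : relation d i c -> relation d i (k *: c).
Proof.
move=> [sc rc]; split=> [|s sd]; last by rewrite linearZ /= rc // scaler0.
exact: leq_trans (size_scale_leq _ _) sc.
Qed.

(** Cancelling the top coefficient of [e] by a multiple of [c] leaves a relation with [d]
    coefficients, which vanishes. *)
Lemma relation_unique d i c e : (d < n)%N -> c != 0 ->
  relation d i c -> relation d i e -> exists k, e = k *: c.
Proof.
move=> dn cn0 rc re; exists (e`_d / c`_d).
have cd : c`_d != 0 by apply: contra cn0 => /eqP /(relation_top dn rc)/eqP.
apply/eqP; rewrite -subr_eq0 -scaleNr; apply/eqP.
apply: (relation_top dn (relationD re (relationZ _ rc))).
by rewrite coefD coefZ mulNr divfK // subrr.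
Qed.

(** The solutions of [d] equations in [d + 2] coefficients form a plane: cancelling the constant
    term of [e] by a multiple of [c] leaves ['X] times a relation at [i + m]. *)
Lemma relation_split d i c c' e : (d < n)%N -> c != 0 -> c' != 0 ->
  relation d i c -> relation d (i + m) c' ->
  (size e <= d.+2)%N -> (forall s, (s < d)%N -> comb a (i + s) e = 0) ->
  exists k k', e = k *: c + k' *: ('X * c').
Proof.
move=> dn cn0 cn0' rc rc' se re; exists (e`_0 / c`_0).
have c0 : c`_0 != 0 by apply: contra cn0 => /eqP /(relation_low dn rc)/eqP.
have [||b eb sb] := @polyX_factor (e - (e`_0 / c`_0) *: c) d.+1.
- by rewrite coefB coefZ divfK // subrr.
- rewrite (leq_trans (size_polyD _ _)) // geq_max se size_polyN.
  by rewrite (leq_trans (size_scale_leq _ _)) // (leq_trans rc.1).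
have rb : relation d (i + m) b.
  split=> // s sd; rewrite addnAC -combX -eb linearB linearZ /= re // rc.2 //.
  by rewrite scaler0 subrr.
have [k' ek'] := relation_unique dn cn0' rc' rb.
by exists k'; rewrite scalerAr -ek' -eb addrC subrK.
Qed.

Lemma relation_exists d i : exists2 c, c != 0 & relation d i c.
Proof.
pose A := \matrix_(l < d.+1, s < d) (a (i + s + l * m)%N : F).
have : kermx A != 0 by rewrite kermx_eq0 neq_ltn ltnS rank_leq_col.
case/rowV0Pn=> v /sub_kermxP vA vn0; exists (rVpoly v).
  by apply: contra vn0 => /eqP e; rewrite -[v]rVpolyK e linear0.
have sv : (size (rVpoly v) <= d.+1)%N by exact: size_poly.
split=> // s sd; rewrite (comb_wide _ _ _ sv).
have /rowP/(_ (Ordinal sd)) := vA; rewrite !mxE; apply: etrans.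
by apply: eq_bigr => l _; rewrite mxE /= coef_rVpoly_ord.
Qed.

End Relations.

(** * Combinations of lifted vertices and the intersection of consecutive diagonals *)

Section Lifts.
Variables (F : fieldType) (m n : nat) (m_gt1 : (1 < m)%N).
Variables (W : nat -> 'rV[F]_m.+1) (x : nat -> F^o).
Implicit Types b c e : {poly F}.
Local Notation comb := (@comb F m _).
Let a : nat -> F^o := fun q => x (q + m)%N - x q.

Definition coord q : 'I_m.+1 :=
  lift ord0 (Ordinal (ltn_pmod q (ltnW m_gt1))).

Hypothesis W_0 : forall p, W p 0 0 = 1.
Hypothesis W_coord :
  forall p q, (p <= q < p + m)%N -> W p 0 (coord q) = x q.
Hypothesis nd : nondegenerate m n a.

Lemma coordD q l : coord (q + l * m) = coord q.
Proof. by congr (lift _ _); apply: val_inj => /=; rewrite addnC modnMDl. Qed.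

Lemma coord_onto p (j : 'I_m.+1) :
  j != 0 -> exists2 q, (p <= q < p + m)%N & j = coord q.
Proof.
case: (unliftP ord0 j) => [i -> _|-> /eqP//].
exists (p + (i + (m - p %% m)) %% m)%N.
  by rewrite leq_addr ltn_add2l ltn_pmod // ltnW.
congr (lift _ _); apply: val_inj => /=.
rewrite modnDmr -(modnDml p) addnCA subnKC; last by rewrite ltnW // ltn_pmod // ltnW.
by rewrite modnDr modn_small.
Qed.

Lemma comb_W0 p c : comb W p c 0 0 = c.[1].
Proof.
rewrite comb_coord -(@comb_const _ m p).
by apply: (@eq_comb _ _ F^o) => l; rewrite W_0.
Qed.

Lemma comb_W_coord p q c : (p <= q < p + m)%N ->
  comb W p c 0 (coord q) = comb x q c.
Proof.
move=> pq; rewrite comb_coord; apply: (@eq_comb _ _ F^o) => l.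
by rewrite -(coordD q l) W_coord //; lia.
Qed.

Lemma comb_aE q c : comb a q c = comb x (q + m)%N c - comb x q c.
Proof. by rewrite -combX -linearB /= -comb_mul_subX1 mulrBr mulr1 mulrC. Qed.

(** [W p] and [W p.+1] list the values of [x] over windows of length [m] that differ only by
    replacing [x p] with [x (p + m)], so the combinations differ by [comb a p c] in [coord p]. *)
Lemma comb_W_step p c : comb W p.+1 c = comb W p c <-> comb a p c = 0.
Proof.
have coord_p : coord p = coord (p + m) by rewrite -[RHS](coordD _ 0) -(coordD p 1) mul1n addn0.
have Wp : comb W p c 0 (coord p) = comb x p c by rewrite comb_W_coord //; lia.
have WpS : comb W p.+1 c 0 (coord p) = comb x (p + m)%N c.
  by rewrite coord_p comb_W_coord //; lia.
split=> [eW|ac]; first by rewrite comb_aE -Wp -WpS eW subrr.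
apply/rowP => j; have [-> | jn0] := eqVneq j 0; first by rewrite !comb_W0.
have [q pq ->] := coord_onto p jn0; have [<-{pq}|neq_pq] := eqVneq p q.
  by apply/eqP; rewrite WpS Wp -subr_eq0 -comb_aE ac.
by rewrite !comb_W_coord //; lia.
Qed.

(* Writing [u + v = b * ('X - 1)], the vanishing of the coordinates of the sum
   turns into the relations which define [b = 0] by nondegeneracy. *)
Lemma comb_W_inj d i (u v : {poly F}) : (d.+1 < n)%N ->
  (size u <= d.+2)%N -> (size v <= d.+2)%N ->
  (forall s, (s < d)%N -> comb a (i + s) u = 0) ->
  (forall s, (s < d)%N -> comb a (i.+1 + s) v = 0) ->
  comb W i u + comb W i.+1 v = 0 -> u + v = 0.
Proof.
move=> dn su sv ru rv uv0; have /factor_theorem[b eb] : root (u + v) 1.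
  have /rowP/(_ 0) := uv0; rewrite !mxE !comb_W0 => h.
  by rewrite /root hornerD h.
have sb : (size b <= d.+1)%N.
  have [->|bn0] := eqVneq b 0; first by rewrite size_poly0.
  have : (size (u + v)%R <= d.+2)%N.
    by rewrite (leq_trans (size_polyD _ _)) // geq_max su.
  by rewrite eb size_Mmonic ?monicXsubC // size_XsubC addn2.
rewrite eb (nd (q := i.+1) dn sb) ?mul0r // => s sd.
rewrite -[LHS]comb_mul_subX1 -eb linearD /=.
(* Without equations ([d = 0]), coordinate [i.+1] still lies in both windows because [m > 1]. *)
case: d => [|d] in dn su sv ru rv sb sd *.
  have /rowP/(_ (coord i.+1)) := uv0; rewrite !mxE.
  rewrite !comb_W_coord; [|lia..].
  by rewrite (_ : (i.+1 + s)%N = i.+1) //; lia.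
(* The first equation for [u] moves it to base [i.+1]; the equations shared by [u] and [v] carry the
   vanishing sum further. *)
have uv0' r : (r < d.+1)%N -> comb W (i.+1 + r) (u + v) = 0.
  elim: r => [_|r IH rd].
    by rewrite addn0 linearD /= [comb W i.+1 u](comb_W_step _ _).2 // -(addn0 i) ru.
  rewrite addnS (comb_W_step _ _).2 ?IH //; first by lia.
  by rewrite linearD /= rv ?[X in _ + X]ru ?addSnnS ?ru ?addr0 //; lia.
(* A window has length at least 2, so the last index [s = d.+1] is still seen from base [r = d]. *)
have [r rd rs] : exists2 r, (r < d.+1)%N & (r <= s <= r.+1)%N.
  by exists (minn s d); lia.
have /rowP/(_ (coord (i.+1 + s))) := uv0' r rd.
by rewrite comb_W_coord ?mxE ?linearD //; lia.
Qed.

(** By [relation_split], these polynomials represent the points of the [m]-diagonal at [p]. *)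
Definition pencil d p (u : {poly F}) :=
  (size u <= d.+2)%N /\ forall s, (s < d)%N -> comb a (p + s) u = 0.

Definition diag p c c' : {vspace 'rV[F]_m.+1} :=
  (<[comb W p c]> + <[comb W (p + m) c']>)%VS.

Lemma comb_diag p c c' k k' :
  comb W p (k *: c + k' *: ('X * c')) =
  k *: comb W p c + k' *: comb W (p + m) c'.
Proof. by rewrite linearD !linearZ /= combX. Qed.

Lemma memv_diag p c c' w :
  reflect (exists k k', w = comb W p (k *: c + k' *: ('X * c'))) (w \in diag p c c').
Proof.
apply: (iffP memv_addP) => [[_ /vlineP[k ->] [_ /vlineP[k' ->] ->]]|[k [k' ->]]].
  by exists k, k'; rewrite comb_diag.
rewrite comb_diag; exists (k *: comb W p c); first exact/memvZ/memv_line.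
by exists (k' *: comb W (p + m) c'); first exact/memvZ/memv_line.
Qed.

Lemma pencil_diag d p c c' k k' : relation m a d p c ->
  relation m a d (p + m) c' -> pencil d p (k *: c + k' *: ('X * c')).
Proof.
move=> [sc rc] [sc' rc']; split=> [|s sd]; last first.
  by rewrite linearD !linearZ /= combX addnAC rc // rc' // !scaler0 addr0.
rewrite (leq_trans (size_polyD _ _)) // geq_max; apply/andP; split.
  exact: leq_trans (size_scale_leq _ _) (leqW sc).
apply: leq_trans (size_scale_leq _ _) (leq_trans (size_polyMleq _ _) _).
by rewrite size_polyX.
Qed.

Lemma pencil_inj d p u v : (d.+1 < n)%N -> pencil d p u -> pencil d p v ->
  comb W p u = comb W p v -> u = v.
Proof.
move=> dn [su ru] [sv rv] uv; apply/eqP; rewrite -subr_eq0 -[_ - _]addr0.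
apply/eqP; apply: (comb_W_inj (d := d) (i := p)) => //.
- by rewrite (leq_trans (size_polyD _ _)) // geq_max size_polyN su.
- by rewrite size_poly0.
- by move=> s sd; rewrite linearB /= ru // rv // subrr.
- by move=> s _; rewrite linear0.
- by rewrite linear0 addr0 linearB /= uv subrr.
Qed.

Section Step.
Variables (d i : nat) (dn : (d.+1 < n)%N).

Lemma dim_diag c c' : c != 0 -> c' != 0 -> relation m a d i c ->
  relation m a d (i + m) c' -> \dim (diag i c c') = 2%N.
Proof.
move=> cn0 cn0' rc rc'.
have pn k k' := pencil_diag k k' rc rc'.
have inj k k' l l' := pencil_inj dn (pn k k') (pn l l').
have free2 : free [:: comb W i c; comb W (i + m) c'].
  rewrite free_cons seq1_free span_seq1; apply/andP; split.
    apply/negP => /vlineP[k ck]; case/eqP: cn0.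
    apply: (relation_low nd (ltnW dn) rc).
    (* Equal vectors give equal polynomials, and comparing constant coefficients shows that the one
       of [c] is zero. *)
    have : 1 *: c + 0 *: ('X * c') = 0 *: c + k *: ('X * c').
      by apply: inj; rewrite !comb_diag ck !scale0r scale1r addr0 add0r.
    move/(congr1 (fun q : {poly F} => q`_0)).
    by rewrite !coefD !coefZ !coefXM /= !mulr0 !addr0 mul1r mul0r.
  apply: contra cn0' => /eqP c'0; have : 0 *: c + 1 *: ('X * c') = 0 *: c + 0 *: ('X * c').
    by apply: inj; rewrite !comb_diag c'0 !scaler0.
  by rewrite !scale0r scale1r !add0r => /eqP; rewrite mulf_eq0 polyX_eq0.
by move: free2; rewrite /free span_cons span_seq1 => /eqP.
Qed.

(** A common point is given by the same polynomial from both bases, which yields the equation at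
    [i]; with the equations of the second pencil this makes order [d + 1], where only multiples of
    [e] are solutions. *)
Lemma diag_cap c0 c1 cm cm1 e : e != 0 ->
  c0 != 0 -> c1 != 0 -> cm != 0 -> cm1 != 0 ->
  relation m a d i c0 -> relation m a d (i + m) cm ->
  relation m a d i.+1 c1 -> relation m a d (i.+1 + m) cm1 ->
  relation m a d.+1 i e ->
  (comb W i e != 0) && (diag i c0 cm :&: diag i.+1 c1 cm1 == <[comb W i e]>)%VS.
Proof.
move=> en0 c0n0 c1n0 cmn0 cm1n0 r0 rm r1 rm1 re.
have [se re'] := re; have step : comb W i.+1 e = comb W i e.
  by apply/comb_W_step; rewrite -(addn0 i) re'.
have pe : pencil d i e by split=> // s sd; rewrite re' // ltnW.
have p0 : pencil d i 0 by split=> [|s sd]; rewrite ?size_poly0 ?linear0.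
apply/andP; split.
  by apply: contra en0 => /eqP e0; apply/eqP/(pencil_inj dn pe p0); rewrite e0 linear0.
rewrite eqEsubv; apply/andP; split; apply/subvP => w.
  rewrite memv_cap => /andP[/memv_diag[k [k' wE]] /memv_diag[l [l' wE']]].
  have [su ru] := pencil_diag k k' r0 rm.
  have [sv rv] := pencil_diag l l' r1 rm1.
  move: wE wE' su ru sv rv; set u := _ + _; set v := _ + _ => wE wE' su ru sv rv.
  have uv : u = v.
    apply/eqP; rewrite -subr_eq0; apply/eqP; apply: (comb_W_inj (d := d) (i := i)) => //.
    - by rewrite size_polyN.
    - by move=> s sd; rewrite linearN /= rv ?oppr0.
    - by rewrite linearN /= -wE -wE' subrr.
  have [|q uq] := relation_unique nd dn en0 re (e := u).
    split=> // -[_|s sd]; last by rewrite uv -addSnnS rv.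
    by apply/comb_W_step; rewrite addn0 -wE uv.
  by rewrite wE uq linearZ /= memvZ // memv_line.
move=> /vlineP[k ->]; rewrite memvZ // memv_cap; apply/andP; split.
  have [q [q' ->]] := relation_split nd (ltnW dn) c0n0 cmn0 r0 rm pe.1 pe.2.
  by apply/memv_diag; exists q, q'.
have re1 s : (s < d)%N -> comb a (i.+1 + s) e = 0 by move=> sd; rewrite addSnnS re'.
have [q [q' eE]] := relation_split nd (ltnW dn) c1n0 cm1n0 r1 rm1 se re1.
by apply/memv_diag; exists q, q'; rewrite -eE step.
Qed.

End Step.
End Lifts.

(** * Cyclic indices and homogeneous lifts of points *)

Lemma val_shift k d (i : 'I_k) : shift d i = ((i + d) %% k)%N :> nat.
Proof.
elim: d => [|d IH]; first by rewrite addn0 modn_small.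
by rewrite /shift iterS -/(shift d i) /= IH -addn1 modnDml addn1 addnS.
Qed.

Definition lift_pt (R : pzRingType) m (v : 'rV[R]_m) : 'rV[R]_m.+1 :=
  row_mx (1%:M : 'rV_1) v.

Lemma lift_pt0 (R : pzRingType) m (v : 'rV[R]_m) : lift_pt v 0 0 = 1.
Proof.
have -> : (0 : 'I_m.+1) = lshift m (0 : 'I_1) by apply: val_inj.
by apply: etrans (row_mxEl _ _ _ _) _; rewrite mxE.
Qed.

Lemma lift_ptS (R : pzRingType) m (v : 'rV[R]_m) j : lift_pt v 0 (lift ord0 j) = v 0 j.
Proof. by rewrite -rshift1; exact: row_mxEr. Qed.

(** * Axis-aligned polygons and the iterated pentagram map *)

Section Polygon.
Variables (R : realType) (m n : nat) (m_gt1 : (1 < m)%N) (n_gt1 : (1 < n)%N).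
Variables (k_gt0 : (0 < m * n)%N) (P : 'M[R]_(m * n, m)).

Definition cyc q : 'I_(m * n) := Ordinal (ltn_pmod q k_gt0).

Definition lift_vertex p : 'rV[R]_m.+1 := lift_pt (row (cyc p) P).

Definition edge_coord q : R^o := P (cyc q) (Ordinal (ltn_pmod q (ltnW m_gt1))).

(** For an axis-aligned [P] this is the signed length of the edge from vertex [q] to vertex [q + 1]:
    the next [m - 1] edges leave that coordinate unchanged. *)
Definition edge q : R^o := edge_coord (q + m)%N - edge_coord q.

Local Notation W := lift_vertex.
Local Notation x := edge_coord.
Local Notation a := edge.

Lemma cycDk q : cyc (q + m * n) = cyc q.
Proof. by apply: val_inj; rewrite /= modnDr. Qed.

Lemma lift_vertex0 p : W p 0 0 = 1.
Proof. exact: lift_pt0. Qed.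

Hypothesis P_axis : axis_aligned P.

Lemma shift_cyc d q : shift d (cyc q) = cyc (q + d).
Proof. by apply: ord_inj; rewrite val_shift /= modnDml. Qed.

Lemma axis_stable p r (j : 'I_m) :
  (forall s, (s < r)%N -> ((p + s) %% m)%N != j) -> P (cyc (p + r)) j = P (cyc p) j.
Proof.
elim: r => [|r IH] neq_j; first by rewrite addn0.
rewrite -IH => [|s sr]; last exact/neq_j/ltnW.
rewrite addnS -addn1 -shift_cyc P_axis //=; apply/eqP.
by rewrite modn_dvdm ?dvdn_mulr // eq_sym neq_j.
Qed.

(** The edges [p], ..., [q - 1] have indices less than [m] away from [q], so none is parallel to the
    axis of edge [q]. *)
Lemma lift_vertex_coord p q : (p <= q < p + m)%N -> W p 0 (coord m_gt1 q) = x q.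
Proof.
move=> pq; rewrite /coord /lift_vertex lift_ptS mxE.
rewrite /edge_coord; set j := Ordinal _; rewrite -[in RHS](@subnKC p q); last by lia.
rewrite axis_stable // => s sr /=.
have neq_mod t : (0 < t < m)%N -> ((p + s) %% m)%N != ((p + s + t) %% m)%N.
  case/andP=> t0 tm; rewrite -{1}[(p + s)%N]addn0 eqn_modDl mod0n modn_small //.
  by rewrite eq_sym -lt0n.
by have := neq_mod (q - (p + s))%N; rewrite subnKC; [apply; lia | lia].
Qed.

Hypothesis nd : nondegenerate m n a.

Definition represents d (V : polygon R m (m * n)) := forall p,
  exists c, [/\ c != 0, relation m a d p c & V (cyc p) = <[comb m W p c]>%VS :> {vspace _}].

Lemma represents0 : represents 0 (proj_polygon P).
Proof.
move=> p; exists 1; split; first exact: oner_neq0; first by split; rewrite ?size_poly1.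
by rewrite ffunE /comb size_poly1 big_ord1 coef1 scale1r addn0.
Qed.

Lemma ord_cyc (i : 'I_(m * n)) : i = cyc i.
Proof. by apply: val_inj; rewrite /= modn_small. Qed.

(** The intersection computed at every [p] gives both the new vertex and, through dimensions, the
    three conditions for the map to be defined. *)
Lemma represents_pentagram d V : (d.+1 < n)%N -> represents d V ->
  exists2 V', pentagram V = Some V' & represents d.+1 V'.
Proof.
move=> dn rV.
have Vdiag p c c' : (V (cyc p) = <[comb m W p c]>%VS :> {vspace _}) ->
  (V (cyc (p + m)%N) = <[comb m W (p + m) c']>%VS :> {vspace _}) ->
  Defs.diagonal V (cyc p) = diag W p c c'.
  by rewrite /Defs.diagonal shift_cyc => -> ->.
have cap p : exists e, [/\ e != 0, relation m a d.+1 p e, comb m W p e != 0,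
    \dim (Defs.diagonal V (cyc p)) = 2%N &
    (Defs.diagonal V (cyc p) :&: Defs.diagonal V (cyc p.+1))%VS = <[comb m W p e]>%VS].
  have [e en0 re] := relation_exists m a d.+1 p; exists e.
  have [c0 [c0n0 r0 V0]] := rV p; have [cm [cmn0 rm Vm]] := rV (p + m)%N.
  have [c1 [c1n0 r1 V1]] := rV p.+1; have [cm1 [cm1n0 rm1 Vm1]] := rV (p.+1 + m)%N.
  rewrite (Vdiag _ _ _ V0 Vm) (Vdiag _ _ _ V1 Vm1).
  have /andP[ne /eqP capE] := diag_cap lift_vertex0 lift_vertex_coord nd dn
    en0 c0n0 c1n0 cmn0 cm1n0 r0 rm r1 rm1 re.
  by rewrite (dim_diag lift_vertex0 lift_vertex_coord nd dn).
have def : pentagram_defined V.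
  apply/and3P; split; apply/forallP => i; rewrite (ord_cyc i);
    have [e [_ _ ne dim2 capE]] := cap i.
  (* Two planes of vectors meeting in a line span dimension [2 + 2 - 1 = 3]. *)
  - have [_ [_ _ _ dim2' _]] := cap i.+1.
    have := dimv_sum_cap (Defs.diagonal V (cyc i)) (Defs.diagonal V (cyc i.+1)).
    rewrite dim2 dim2' capE dim_vline ne => /eqP; rewrite (eqn_add2r 1 _ 3) => /eqP <-.
    apply/eqP; congr (\dim _); rewrite /Defs.diagonal !shift_cyc addn1 addSnnS.
    rewrite !addvA; congr (_ + _)%VS; rewrite -!addvA; congr (_ + _)%VS.
    exact: addvC.
  - apply/eqP => VV; move: dim2; rewrite /Defs.diagonal -VV addvv.
    by have [c [_ _ ->]] := rV i; rewrite dim_vline; case: (_ != _).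
  apply/eqP; rewrite shift_cyc addn1 => DD; move: capE; rewrite -DD capvv => DE.
  by move: dim2; rewrite DE dim_vline ne.
exists [ffun i => insubd (V i) (Defs.diagonal V i :&: Defs.diagonal V (shift 1 i))%VS].
  by rewrite /pentagram def.
move=> p; have [e [en0 re ne dim2 capE]] := cap p; exists e; split=> //.
rewrite ffunE insubdK ?unfold_in ?dim_diagonal_cap //.
by rewrite shift_cyc addn1 capE.
Qed.

Lemma represents_iter d : (d < n)%N ->
  exists2 V, pentagram_iter d (proj_polygon P) = Some V & represents d V.
Proof.
elim: d => [|d IH] dn; first by exists (proj_polygon P) => //; exact: represents0.
have [V eV rV] := IH (ltnW dn); have [V' eV' rV'] := represents_pentagram dn rV.
by exists V' => //; rewrite /pentagram_iter iterS -/(pentagram_iter _ _) eV.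
Qed.

Definition cycle_sum : {poly R} := \poly_(l < n) 1.

Lemma comb_cycle_sum (U : lmodType R) (u : nat -> U) p :
  comb m u p cycle_sum = \sum_(l < n) u (p + l * m)%N.
Proof.
rewrite (comb_wide _ _ _ (size_poly _ _)); apply: eq_bigr => l _.
by rewrite coef_poly ltn_ord scale1r.
Qed.

(** Telescopes to [x (q + m * n) - x q], which vanishes because the polygon closes up. *)
Lemma comb_edge_cycle_sum q : comb m a q cycle_sum = 0.
Proof.
rewrite comb_cycle_sum.
rewrite (eq_bigr (fun l : 'I_n => x (q + l.+1 * m)%N - x (q + l * m)%N)) => [|l _]; last first.
  by rewrite /edge mulSn [(m + _)%N]addnC addnA.
rewrite -(big_mkord xpredT (fun l => x (q + l.+1 * m)%N - x (q + l * m)%N)).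
rewrite telescope_sumr // mul0n addn0 mulnC.
suff -> : x (q + m * n)%N = x q by rewrite subrr.
rewrite /edge_coord cycDk; congr (P _ _); apply: val_inj => /=.
by rewrite addnC mulnC modnMDl.
Qed.

Lemma sum_lift_vertex t :
  \sum_(p < m * n) W (p + t)%N = \sum_(p < m * n) W p.
Proof.
elim: t => [|t IH]; first by apply: eq_bigr => p _; rewrite addn0.
rewrite -IH -(big_mkord xpredT (fun p => W (p + t.+1))) -(big_mkord xpredT (fun p => W (p + t))).
apply: (addrI (W (0 + t)%N)).
rewrite (eq_bigr (fun p => W (p.+1 + t)%N)) => [|p _]; last by rewrite addSnnS.
rewrite -(big_nat_recl _ 0%N (fun p => W (p + t)%N)) // big_nat_recr //= addrC.
by congr (_ + _); rewrite addnC /lift_vertex cycDk.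
Qed.

(** The combination does not depend on [p]; summed over all bases it counts every vertex [n]
    times. *)
Lemma comb_lift_cycle_sum p : comb m W p cycle_sum =
  n%:R *: lift_pt (center_of_mass P).
Proof.
have const q : comb m W q cycle_sum = comb m W 0 cycle_sum.
  elim: q => // q <-; apply/(comb_W_step lift_vertex0 lift_vertex_coord).
  exact: comb_edge_cycle_sum.
have k_n0 : (m * n)%:R != 0 :> R by rewrite pnatr_eq0 -lt0n.
have : (m * n)%:R *: comb m W p cycle_sum = n%:R *: \sum_(q < m * n) W q.
  transitivity (\sum_(q < m * n) comb m W q cycle_sum).
    rewrite const scaler_nat -{1}(card_ord (m * n)) -sumr_const.
    by apply: eq_bigr => q _; rewrite const.
  under eq_bigr do rewrite comb_cycle_sum.
  rewrite exchange_big /=; under eq_bigr do rewrite sum_lift_vertex.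
  by rewrite sumr_const card_ord scaler_nat.
move/(canRL (scalerK k_n0)) => ->; rewrite scalerA mulrC -scalerA; congr (_ *: _).
apply/rowP => j; rewrite mxE summxE; case: (unliftP ord0 j) => [i|] ->.
  rewrite lift_ptS mxE summxE; congr (_ * _); apply: eq_bigr => q _.
  by rewrite lift_ptS -ord_cyc.
rewrite lift_pt0 (eq_bigr (fun=> 1)) => [|q _]; last by rewrite lift_pt0.
by rewrite sumr_const card_ord mulVf.
Qed.

Lemma pentagram_collapse :
  pentagram_iter n.-1 (proj_polygon P) = Some [ffun=> affine_pt (center_of_mass P)].
Proof.
have n1 : (n.-1 < n)%N by rewrite ltn_predL ltnW.
have [V -> rV] := represents_iter n1; congr Some; apply/ffunP => i.
rewrite ffunE (ord_cyc i); apply: val_inj; have [c [cn0 rc]] := rV i; rewrite /= => ->.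
have rJ : relation m a n.-1 i cycle_sum.
  by split=> [|s _]; [rewrite prednK ?size_poly // ltnW | exact: comb_edge_cycle_sum].
have [k kE] := relation_unique nd n1 cn0 rc rJ.
have := comb_lift_cycle_sum i; rewrite kE linearZ /= => e.
have n_n0 : n%:R != 0 :> R by rewrite pnatr_eq0 -lt0n ltnW.
(* Homogeneous coordinate 0 of the right side of [e] is [n], so [k] cannot vanish. *)
have k_n0 : k != 0.
  apply: contraNneq n_n0 => k0; have /rowP/(_ 0) := e.
  by rewrite k0 scale0r mxE [RHS]mxE lift_pt0 mulr1 => <-.
apply/eqP; rewrite eqEsubv; apply/andP; split; apply/subvP => _ /vlineP[l ->].
  apply/memvZ/vlineP; exists (k^-1 * n%:R).
  by rewrite -scalerA -/(lift_pt _) -e scalerA mulVf // scale1r.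
apply/memvZ/vlineP; exists (n%:R^-1 * k).
by rewrite -scalerA e scalerA mulVf // scale1r.
Qed.

End Polygon.

(** * Common nonvanishing of functions that are polynomial on lines *)

Definition line_poly (R : comNzRingType) (V : lmodType R) (f : V -> R) :=
  forall u v, exists p : {poly R}, forall t, f (u + t *: v) = p.[t].

Lemma poly_nonroot (R : numDomainType) (p : {poly R}) :
  p != 0 -> exists t, p.[t] != 0.
Proof.
move=> pn0; pose rs : seq R := [seq i%:R | i <- iota 0 (size p)].
have rs_uniq : uniq rs.
  by rewrite map_inj_uniq ?iota_uniq // => i j /eqP; rewrite eqr_nat => /eqP.
have : ~~ all (root p) rs.
  by apply/negP => /(max_poly_roots pn0)/(_ rs_uniq); rewrite size_map size_iota ltnn.
by case/allPn=> t _ nr; exists t.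
Qed.

Lemma line_poly_prod (R : comNzRingType) (V : lmodType R) I (s : seq I)
    (f : I -> V -> R) :
  (forall i, line_poly (f i)) -> line_poly (fun v => \prod_(i <- s) f i v).
Proof.
move=> f_poly u v; elim: s => [|i s [q qE]].
  by exists 1 => t; rewrite big_nil hornerE.
have [p pE] := f_poly i u v.
by exists (p * q) => t; rewrite big_cons hornerM pE qE.
Qed.

(** On the line from [u], where the product over [s] is nonzero, to [v], where [f i] is nonzero,
    both are nonzero univariate polynomials, hence so is their product. *)
Lemma common_nonzero (R : numDomainType) (V : lmodType R) (A : V -> Prop)
    (I : Type) (s : seq I) (f : I -> V -> R) :
  (forall u v t, A u -> A v -> A (u + t *: (v - u))) -> (exists v, A v) ->
  (forall i, line_poly (f i)) -> (forall i, exists2 v, A v & f i v != 0) ->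
  exists2 v, A v & \prod_(i <- s) f i v != 0.
Proof.
move=> A_line [v0 Av0] f_poly f_n0.
elim: s => [|i s IH]; first by exists v0; rewrite ?big_nil ?oner_eq0.
have [u Au un0] := IH; have [v Av vn0] := f_n0 i.
have [p pE] := f_poly i u (v - u); have [q qE] := line_poly_prod s f_poly u (v - u).
have pn0 : p != 0.
  by apply: contraNneq vn0 => p0; rewrite -[v](subrKC u) -[v - u]scale1r pE p0 horner0.
have qn0 : q != 0.
  by apply: contraNneq un0 => q0; rewrite -[u]addr0 -[0](scale0r (v - u)) qE q0 horner0.
have [t tn0] := poly_nonroot (mulf_neq0 pn0 qn0).
exists (u + t *: (v - u)); first exact: A_line.
by rewrite big_cons pE qE -hornerM.
Qed.

Lemma line_poly_det (R : comNzRingType) (V : lmodType R) d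
    (L : 'I_d -> 'I_d -> V -> R) :
  (forall l s u v t, L l s (u + t *: v) = L l s u + t * L l s v) ->
  line_poly (fun v => \det (\matrix_(l, s) L l s v)).
Proof.
move=> L_lin u v; exists (\det (\matrix_(l, s) ((L l s u)%:P + 'X * (L l s v)%:P))).
move=> t; rewrite -[RHS]/(horner_eval t _) -det_map_mx; congr (\det _).
by apply/matrixP => l s; rewrite !mxE /= /horner_eval !hornerE L_lin.
Qed.

(** * The generic condition, and polygons at which each determinant is nonzero *)

Section Generic.
Variables (R : realType) (m n : nat) (m_gt1 : (1 < m)%N) (n_gt1 : (1 < n)%N).
Variables (k_gt0 : (0 < m * n)%N).
Implicit Types P : 'M[R]_(m * n, m).
Local Notation x := (edge_coord m_gt1 k_gt0).
Local Notation a := (edge m_gt1 k_gt0).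

Definition edge_det d q P := \det (\matrix_(l < d, s < d) a P (q + s + l * m)%N).

(* The subscript of y is the first index congruent to j that is at least i, which
   makes [edge_coord] of this polygon equal to y. *)
Definition axis_polygon (y : nat -> R) : 'M[R]_(m * n, m) :=
  \matrix_(i, j) y (j + m * ((i + (m.-1 - j)) %/ m))%N.

(** The quotient changes between rows [i] and [i + 1] only if [j] is [i mod m]; at the closing edge
    it drops by [n], which the period of [y] absorbs. *)
Lemma axis_polygonP y : (forall q, y (q + m * n)%N = y q) ->
  axis_aligned (axis_polygon y).
Proof.
move=> y_per i j neq_ij; rewrite !mxE val_shift.
have step : ((i.+1 + (m.-1 - j)) %/ m = (i + (m.-1 - j)) %/ m)%N.
  have := divn_eq i m; have := ltn_pmod i (ltnW m_gt1); have := ltn_ord j.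
  move: neq_ij; set r := (i %% m)%N; set t := (i %/ m)%N => neq_ij jm rm ->.
  rewrite -addnS -!addnA !divnMDl ?(ltnW m_gt1) //.
  congr addn.
  have [lt_rj|] := ltnP r j; first by rewrite !divn_small //; lia.
  move=> le_jr; have ltjr : (j < r)%N by lia.
  have -> : (r.+1 + (m.-1 - j) = 1 * m + (r - j))%N by lia.
  have -> : (r + (m.-1 - j) = 1 * m + (r - j).-1)%N by lia.
  by rewrite !divnMDl ?(ltnW m_gt1) // !divn_small //; lia.
have [lt_i|] := ltnP (i + 1) (m * n); first by rewrite modn_small // addn1 step.
rewrite leq_eqVlt => /predU1P[ik|]; last by have := ltn_ord i; lia.
rewrite -ik modnn -step -[i.+1]addn1 -ik add0n.
have -> z : ((m * n + z) %/ m = n + z %/ m)%N by rewrite mulnC divnMDl // ltnW.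
by rewrite mulnDr addnCA [(m * n + _)%N]addnC y_per.
Qed.

Lemma edge_coord_axis_polygon y q : (forall p, y (p + m * n)%N = y p) ->
  x (axis_polygon y) q = y q.
Proof.
move=> y_per; rewrite /edge_coord mxE /=.
have y_perM p t : y (p + t * (m * n))%N = y p.
  by elim: t => [|t IH]; rewrite ?addn0 // mulSn addnCA [(m * n + _)%N]addnC y_per.
have -> : y q = y (q %% (m * n))%N.
  by rewrite {1}(divn_eq q (m * n)) addnC y_perM.
congr y.
rewrite -(modn_dvdm q (dvdn_mulr n (dvdnn m))).
set i := (q %% _)%N; rewrite {2}(divn_eq i m) -addnA divnMDl ?(ltnW m_gt1) //.
rewrite subnKC; last by have := ltn_pmod i (ltnW m_gt1); lia.
rewrite (@divn_small m.-1) ?addn0; last by lia.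
by rewrite [RHS](divn_eq i m) addnC mulnC.
Qed.

(* The rows s < d of (x_(q+s+lm))_(s, l) with s = r mod m are successive shifts of
   one row.  A single 1 in each of these rows can be placed so that the columns
   it occupies are consecutive, the last one, reached at s = r, being [tile d r], and so
   that these intervals tile the columns l < d as r varies. *)
Definition tile d r := (d %/ m * r + d %/ m + minn r.+1 (d %% m)).-1.

Lemma tile_lt d r : (0 < d)%N -> (r < m)%N -> (tile d r < d)%N.
Proof.
rewrite /tile => d_gt0 rm; have := divn_eq d m.
have : (d %/ m * r + d %/ m <= d %/ m * m)%N by rewrite -mulnSr leq_mul2l rm orbT.
by lia.
Qed.

(** The least [r] with [l <= tile d r] works: the interval ending there has as many columns as there
    are rows [s < d] congruent to [r], namely [d %/ m + (r < d %% m)]. *)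
Lemma tile_cover d l : (l < d)%N ->
  exists r j, [/\ (r < m)%N, (r + m * j < d)%N & (j + l = tile d r)%N].
Proof.
move=> ld; set Q := (d %/ m)%N; set rho := (d %% m)%N.
have dE : d = (Q * m + rho)%N := divn_eq d m.
have rho_lt : (rho < m)%N := ltn_pmod d (ltnW m_gt1).
have tileS r : tile d r = (Q * r.+1 + minn r.+1 rho).-1 by rewrite /tile mulnSr.
have l_top : (l <= tile d m.-1)%N by rewrite tileS (ltn_predK m_gt1); lia.
case: (ex_minnP (ex_intro (fun r => (l <= tile d r)%N) _ l_top)) => r lr r_min.
have rm : (r < m)%N by have := r_min _ l_top; lia.
exists r, (tile d r - l)%N; split=> //; last by rewrite subnK.
have J_lt : (tile d r - l < Q + (r < rho))%N.
  case: r => [|r] in lr r_min rm *; first by move: lr; rewrite tileS muln1; lia.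
  have : (tile d r < l)%N by rewrite ltnNge; apply/negP => /r_min; rewrite ltnn.
  by move: lr; rewrite !tileS [(Q * r.+2)%N]mulnSr; lia.
have : (m * (tile d r - l).+1 <= m * (Q + (r < rho)))%N by rewrite leq_mul2l J_lt orbT.
move: (tile d r - l)%N => J.
move: dE; rewrite mulnS mulnDr [(Q * m)%N]mulnC.
by case: (ltnP r rho) => r_rho; rewrite ?muln1 ?muln0; lia.
Qed.

(** [e] is the offset of [p] from [q] around the cycle; adding [m * n - q %% (m * n)] subtracts [q]
    without truncation. *)
Definition delta d q p : R :=
  let e := ((p + (m * n - q %% (m * n))) %% (m * n))%N in
  (e %/ m == tile d (e %% m))%N%:R.

Lemma delta_periodic d q p : delta d q (p + m * n)%N = delta d q p.
Proof. by rewrite /delta addnAC modnDr. Qed.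

Lemma deltaE d q r j l : (r < m)%N ->
  delta d q (q + (r + m * j) + l * m)%N = ((j + l) %% n == tile d r)%N%:R.
Proof.
move=> rm; rewrite /delta; set e := ((q + _ + _ + _) %% _)%N.
suff -> : e = ((j + l) %% n * m + r)%N.
  by rewrite divnMDl ?(ltnW m_gt1) // (divn_small rm) addn0 modnMDl (modn_small rm).
have qE : (q + (m * n - q %% (m * n)) = (q %/ (m * n) + 1) * (m * n))%N.
  rewrite {1}(divn_eq q (m * n)) -addnA subnKC; last by rewrite ltnW // ltn_pmod.
  by rewrite mulnDl mul1n.
have jlE : (r + m * j + l * m = (j + l) %/ n * (m * n) + ((j + l) %% n * m + r))%N.
  transitivity ((j + l) * m + r)%N; first by lia.
  by rewrite {1}(divn_eq (j + l) n) mulnDl -mulnA [(n * m)%N]mulnC addnA.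
rewrite /e -(addnA q) addnAC qE jlE !modnMDl modn_small //.
have : (((j + l) %% n).+1 * m <= n * m)%N by rewrite leq_mul2r ltn_pmod ?orbT // ltnW.
by rewrite mulSn [(n * m)%N]mulnC; lia.
Qed.

(** With [b = c * ('X - 1)], each row picked by [tile_cover] reads off one coefficient of [b], and
    [b.[1] = 0] gives the last one. *)
Lemma edge_det_delta d q : (d < n)%N -> edge_det d q (axis_polygon (delta d q)) != 0.
Proof.
move=> dn; pose P := axis_polygon (delta d q).
apply/negP => /det0P[v vn0 vA]; case/eqP: vn0.
pose c := rVpoly v; have sc : (size c <= d)%N by exact: size_poly.
rewrite -[v]rVpolyK -/c; suff -> : c = 0 by rewrite linear0.
pose b := c * ('X - 1%:P).
have sb : (size b <= d.+1)%N.
  by rewrite (leq_trans (size_polyMleq _ _)) // size_XsubC addn2.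
have b1 : b.[1] = 0 by rewrite !hornerE subrr mulr0.
have b_l l : (l < d)%N -> b`_l = 0.
  move=> ld; have [r [j [rm sd jl]]] := tile_cover ld.
  have c_s : comb m (a P) (q + (r + m * j)) c = 0.
    have /rowP/(_ (Ordinal sd)) := vA; rewrite !mxE; apply: etrans.
    by rewrite (comb_wide _ _ _ sc); apply: eq_bigr => i _; rewrite mxE coef_rVpoly_ord.
  rewrite -[RHS]c_s -[RHS]comb_mul_subX1 -/b (comb_wide _ _ _ (leq_trans sb dn)).
  have ln : (l < n)%N := ltn_trans ld dn.
  (* As [b] has at most [d + 1 <= n] coefficients, the index [l] alone hits the 1 of this row. *)
  rewrite (bigD1 (Ordinal ln)) //= big1 => [|i neq_i].
    rewrite addr0 edge_coord_axis_polygon; last exact: delta_periodic.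
    rewrite deltaE // jl modn_small ?eqxx ?[_ *: _]mulr1 //.
    by rewrite (leq_trans (tile_lt _ rm)) // ?(ltnW dn) // (leq_ltn_trans _ ld).
  rewrite edge_coord_axis_polygon; last exact: delta_periodic.
  rewrite deltaE // -jl (_ : _ == _ = false) ?scaler0 //.
  apply: contraNF neq_i => /eqP e; rewrite -val_eqE /=.
  have : (j + i == j + l %[mod n])%N.
    by rewrite e modn_small // jl (leq_trans (tile_lt _ rm)) // ?(ltnW dn) // (leq_ltn_trans _ ld).
  by rewrite eqn_modDl !modn_small.
have b0 : b = 0.
  apply/polyP => l; rewrite coef0; have [/b_l//|] := ltnP l d.
  rewrite leq_eqVlt => /predU1P[<-|dl]; last by rewrite nth_default // (leq_trans sb).
  rewrite -[RHS]b1 (horner_coef_wide _ sb) big_ord_recr /= expr1n mulr1 big1 ?add0r // => i _.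
  by rewrite b_l ?mul0r.
by apply/eqP; move/eqP: b0; rewrite mulf_eq0 polyXsubC_eq0 orbF.
Qed.

Lemma edge_linear q P Q t : a (P + t *: Q) q = a P q + t * a Q q.
Proof. by rewrite /edge /edge_coord !mxE mulrBr opprD addrACA. Qed.

Lemma axis_aligned_line P Q (t : R) : axis_aligned P -> axis_aligned Q ->
  axis_aligned (P + t *: (Q - P)).
Proof. by move=> PA QA i j ij; rewrite !mxE PA // QA. Qed.

(** Periodicity leaves only finitely many [q] to control. *)
Lemma edge_mod P q : a P (q %% (m * n)) = a P q.
Proof.
have x_mod r : x P (r %% (m * n)) = x P r.
  by rewrite /edge_coord; congr (P _ _); apply: val_inj => /=;
    rewrite ?modn_mod ?modn_dvdm ?dvdn_mulr.
by rewrite /edge x_mod -x_mod modnDml x_mod.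
Qed.

Lemma nondegenerate_edge P :
  (forall (d : 'I_n) (q : 'I_(m * n)), edge_det d q P != 0) ->
  nondegenerate m n (a P).
Proof.
move=> det_n0; apply: nondegenerate_det => d q dn.
have := det_n0 (Ordinal dn) (Ordinal (ltn_pmod q k_gt0)); congr (\det _ != _).
apply/matrixP => l s; rewrite !mxE /= -edge_mod -[RHS]edge_mod.
by rewrite -!addnA modnDml.
Qed.

Definition edge_var q : {mpoly R[m * n * m]} :=
  'X_(mxvec_index (cyc k_gt0 (q + m)) (Ordinal (ltn_pmod (q + m) (ltnW m_gt1)))) -
  'X_(mxvec_index (cyc k_gt0 q) (Ordinal (ltn_pmod q (ltnW m_gt1)))).

Definition generic_poly : {mpoly R[m * n * m]} :=
  \prod_(i : 'I_n * 'I_(m * n))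
    \det (\matrix_(l < i.1, s < i.1) edge_var (i.2 + s + l * m)).

Lemma generic_polyE P : generic_poly.@[fun i => mxvec P 0 i] =
  \prod_(i : 'I_n * 'I_(m * n)) edge_det i.1 i.2 P.
Proof.
rewrite rmorph_prod; apply: eq_bigr => i _; rewrite -det_map_mx; congr (\det _).
by apply/matrixP => l s; rewrite !mxE /= mevalB !mevalXU !mxvecE.
Qed.

End Generic.

Theorem theorem1p4 (R : realType) (m n : nat) (hm : (3 <= m)%N)
    (hn : (2 <= n)%N) :
  generically (@axis_aligned R m n)
    (fun P : 'M[R]_(m * n, m) =>
       pentagram_iter n.-1 (proj_polygon P) =
       Some [ffun=> affine_pt (center_of_mass P)]).
Proof.
have m_gt1 : (1 < m)%N := ltnW hm.
have k_gt0 : (0 < m * n)%N by rewrite muln_gt0 (ltnW m_gt1) (ltnW hn).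
pose G := generic_poly R m_gt1 k_gt0.
exists (@axis_aligned R m n `&`
  [set P | exists2 f, f = G & f.@[fun i => mxvec P 0 i] != 0])%classic.
split; first by exists [set G]%classic.
  (* A point of the open set: each factor is nonzero at the polygon of some [delta], and lines join
     such polygons inside the space. *)
  have [|||i|P PA Pn0] := @common_nonzero R _ (@axis_aligned R m n) _
      (index_enum ('I_n * 'I_(m * n))%type)
      (fun i P => edge_det m_gt1 k_gt0 i.1 i.2 P).
  - by move=> P Q t; apply: axis_aligned_line.
  - by exists 0 => i j _; rewrite !mxE.
  - by move=> i; apply: line_poly_det => l s P Q t; apply: edge_linear.
  - exists (axis_polygon m n (delta R m n i.1 i.2)).
      exact/axis_polygonP/delta_periodic.
    exact: edge_det_delta.
  by exists P; split=> //; exists G => //; rewrite generic_polyE.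
move=> P [PA [_ -> Gn0]]; apply: (@pentagram_collapse _ _ _ m_gt1 hn k_gt0) => //.
apply: nondegenerate_edge => d q; move: Gn0; rewrite generic_polyE.
by move/prodf_neq0/(_ (d, q) isT).
Qed.
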